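(* Let $G$ be a finite group, $\mathbb{K}$ a field of characteristic zero, and let $\mathcal{R}:(\mathbb{Z},\leq)\to\mathbf{Rep}_{\mathbb{K}}^{G}$ be a finite persistence representation. Then there exists a finite collection $\{\mathcal{R}_i\}_{i\in I}$ of irreducible persistence representations such that $$\mathcal{R}\cong\bigoplus_{i\in I}\mathcal{R}_i,$$ where each $\mathcal{R}_i$ is an irreducible persistence representation supported on an interval $[s_i,t_i]$.
   Context: $\mathbf{Rep}_{\mathbb{K}}^{G}$ is the category of finite-dimensional $\mathbb{K}$-linear representations of the fixed group $G$, with $G$-equivariant linear maps. A persistence representation is a functor $\mathcal{R}:(\mathbb{Z},\leq)\to\mathbf{Rep}_{\mathbb{K}}^{G}$, $\mathcal{R}_t=(G,V_t,\rho_t)$, with structure maps $f_{s,t}:V_s\to V_t$ for $s\leq t$. $\mathcal{R}$ is finite if there exist integers $p$ and $q$ such that the structure map $\mathcal{R}_{p_1}\to\mathcal{R}_{p_2}$ is an isomorphism for all $p_1\leq p_2\leq p$ and the structure map $\mathcal{R}_{q_1}\to\mathcal{R}_{q_2}$ is an isomorphism for all $q\leq q_1\leq q_2$. A persistence representation is irreducible supported on an interval $B\subseteq\mathbb{Z}$ if: $V_r$ is an irreducible $G$-representation for all $r\in B$; $V_r=0$ for all $r\notin B$; and for all $r\leq s$ in $B$ the structure map $f_{r,s}:V_r\to V_s$ is an isomorphism. In $[s_i,t_i]$ the endpoints may be infinite: $s_i\in\mathbb{Z}\cup\{-\infty\}$, $t_i\in\mathbb{Z}\cup\{+\infty\}$.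 Direct sums and isomorphisms are taken in the category of functors $(\mathbb{Z},\leq)\to\mathbf{Rep}_{\mathbb{K}}^{G}$. *)

(* Defs.v *)
From HB Require Import structures.
From mathcomp Require Import all_boot all_order all_algebra all_fingroup.
From mathcomp Require Import mxrepresentation character.

Set Implicit Arguments.
Unset Strict Implicit.
Unset Printing Implicit Defensive.

Import Order.TTheory GRing.Theory Num.Theory.
Local Open Scope ring_scope.

Section PersistenceRepresentations.

Variables (K : fieldType) (gT : finGroupType) (G : {group gT}).

(* Objects of Rep_K^G are MathComp's [representation K G]: homomorphisms from G
   to GL_n(K), acting on the row vectors of K^n by right multiplication.
   Accordingly a linear map from K^m to K^n is an m x n matrix f acting by
   v |-> v *m f, and the composite "f, then g" is f *m g. Precomposing with
   x |-> x^-1 identifies these right representations with left ones. *)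
Definition intertwines (V W : representation K G)
    (f : 'M[K]_(rdegree V, rdegree W)) : Prop :=
  forall x, x \in G -> V x *m f = f *m W x.

Definition rep_iso (V W : representation K G)
    (f : 'M[K]_(rdegree V, rdegree W)) : Prop :=
  intertwines f /\
  exists g : 'M[K]_(rdegree W, rdegree V),
    [/\ intertwines g, f *m g = 1%:M & g *m f = 1%:M].

Record pers_rep : Type := PersRep {
  pobj :> int -> representation K G;
  pmap : forall s t : int, s <= t -> 'M[K]_(rdegree (pobj s), rdegree (pobj t));
  pmap_intertwines : forall (s t : int) (le_st : s <= t),
    intertwines (pmap le_st);
  pmap_id : forall (t : int) (le_tt : t <= t), pmap le_tt = 1%:M;
  pmap_comp : forall (r s t : int) (le_rs : r <= s) (le_st : s <= t)
    (le_rt : r <= t), pmap le_rt = pmap le_rs *m pmap le_st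
}.

Record pers_hom (R S : pers_rep) : Type := PersHom {
  phom :> forall t : int, 'M[K]_(rdegree (R t), rdegree (S t));
  phom_intertwines : forall t : int, intertwines (phom t);
  phom_natural : forall (s t : int) (le_st : s <= t),
    phom s *m pmap S le_st = pmap R le_st *m phom t
}.

Definition pers_iso (R S : pers_rep) : Prop :=
  exists (phi : pers_hom R S) (psi : pers_hom S R),
    forall t : int, phi t *m psi t = 1%:M /\ psi t *m phi t = 1%:M.

Program Definition pers_zero : pers_rep :=
  @PersRep (fun _ => grepr0) (fun _ _ _ => 1%:M) _ _ _.
Next Obligation. by move=> s t le_st x Gx; apply/matrixP=> -[]. Qed.
Next Obligation. by []. Qed.
Next Obligation. by move=> r s t le_rs le_st le_rt; rewrite mulmx1. Qed.

Program Definition pers_dadd (R S : pers_rep) : pers_rep :=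
  @PersRep (fun t => dadd_grepr (R t) (S t))
    (fun s t le_st => block_mx (pmap R le_st) 0 0 (pmap S le_st)) _ _ _.
Next Obligation.
move=> R S s t le_st x Gx /=.
rewrite !mulmx_block !(mulmx0, mul0mx, addr0, add0r).
by rewrite !pmap_intertwines.
Qed.
Next Obligation.
by move=> R S t le_tt /=; rewrite !pmap_id -scalar_mx_block.
Qed.
Next Obligation.
move=> R S r s t le_rs le_st le_rt /=.
rewrite mulmx_block !(mulmx0, mul0mx, addr0, add0r).
by rewrite -!pmap_comp.
Qed.

Definition pers_finite (R : pers_rep) : Prop :=
  exists p q : int,
    (forall (p1 p2 : int) (le12 : p1 <= p2), p2 <= p -> rep_iso (pmap R le12))
    /\
    (forall (q1 q2 : int) (le12 : q1 <= q2), q <= q1 -> rep_iso (pmap R le12)).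

Definition pers_irreducible_on (B : interval int) (R : pers_rep) : Prop :=
  [/\ forall r : int, r \in B -> mx_irreducible (R r),
      forall r : int, r \notin B -> rdegree (R r) = 0%N &
      forall (r s : int) (le_rs : r <= s), r \in B -> s \in B ->
        rep_iso (pmap R le_rs)].

End PersistenceRepresentations.

Arguments pers_zero {K gT G}.

(* The interval [s, t] of integers; None encodes the endpoint -oo on the left
   and +oo on the right. *)
Definition closed_itv (s t : option int) : interval int :=
  Interval (if s is Some a then BLeft a else -oo%O)
           (if t is Some b then BRight b else +oo%O).

(* Main.v *)
Require Import Defs.
From Stdlib Require Import Classical_Prop.
From HB Require Import structures.
From mathcomp Require Import all_boot all_order all_algebra all_fingroup.
From mathcomp Require Import mxrepresentation character.
From mathcomp Require Import zify.

(** The proof peels off one interval summand at a time, by induction on the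
total degree of [R] over a window [[p, q]] outside of which all structure maps
are invertible.

Clamping the index into [[p, q]] does not change [R] up to isomorphism
([pers_clamp_iso]), so it suffices to find a summand inside the window; a bar
that touches an end of the window then extends to an infinite bar.

Let [b] be the first index of the window with [R b] nonzero. Choose an
irreducible subrepresentation [u : W -> R b], and let [c] be the last index of
the window at which the image of [u] survives. By Schur, [W] still embeds into
[R c], and by Maschke this embedding has an equivariant retraction [pi]
([Maschke_retraction]; this is where characteristic zero enters). For
[b <= t <= c], following [u] forward to [t] embeds [W] into [R t], and
[R t -> R c -> W] retracts this embedding. Hence
[e t = (R t -> R c -> W -> R b -> R t)] is an idempotent with image [W]. Put
[e t = 0] elsewhere. This [e] is natural: maps entering [[b, c]] from the left
start at zero, since [b] is the first nonzero index, and maps leaving it on the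
right kill the image of [u], since [c] is the last index of survival
([exists_bar]).

A natural idempotent splits a persistence representation into its image and the
image of its complement ([pers_im_split]). The image of [e] is irreducible on
an interval ([bar_irreducible]). The complement again has invertible structure
maps outside of the window, and its total degree is smaller, so the induction
proceeds ([decomposable_window]).

Maps act on row vectors on the right, so composites read from left to right. *)

Set Implicit Arguments.
Unset Strict Implicit.
Unset Printing Implicit Defensive.

Import Order.TTheory GRing.Theory Num.Theory.
Local Open Scope ring_scope.

(* [seq.pmap] would otherwise hide the structure maps. *)
Local Notation pmap := Defs.pmap.

(** * Intertwiners, Schur and Maschke *)

Section Intertwiners.

Variables (K : fieldType) (gT : finGroupType) (G : {group gT}).
Implicit Types U V W : representation K G.

Lemma intertwines1 V : @intertwines K gT G V V 1%:M.
Proof. by move=> x _; rewrite mulmx1 mul1mx. Qed.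

Lemma intertwines0 V W : @intertwines K gT G V W 0.
Proof. by move=> x _; rewrite mulmx0 mul0mx. Qed.

Lemma intertwinesM U V W (f : 'M_(rdegree U, rdegree V))
    (g : 'M_(rdegree V, rdegree W)) :
  intertwines f -> intertwines g -> intertwines (f *m g).
Proof. by move=> Hf Hg x Gx; rewrite mulmxA Hf // -!mulmxA Hg. Qed.

Lemma intertwines1B V (f : 'M_(rdegree V)) :
  @intertwines K gT G V V f -> @intertwines K gT G V V (1%:M - f).
Proof.
by move=> Hf x Gx; rewrite mulmxBr mulmxBl mulmx1 mul1mx Hf.
Qed.

Lemma rep_iso1 V : @rep_iso K gT G V V 1%:M.
Proof.
split; first exact: intertwines1.
by exists 1%:M; split; rewrite ?mulmx1 //; apply: intertwines1.
Qed.

(** The inverse of an isomorphism as a function of the matrix, so that inverses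
of a whole family of isomorphisms are obtained without choice. *)
Lemma rep_iso_pinv V W (f : 'M_(rdegree V, rdegree W)) :
  rep_iso f -> [/\ intertwines (pinvmx f), f *m pinvmx f = 1%:M
                 & pinvmx f *m f = 1%:M].
Proof.
case=> _ [g [Hg fg gf]].
suff -> : pinvmx f = g by [].
have /mulmxVp fp : row_free f by apply/row_freeP; exists g.
by rewrite -[pinvmx f]mul1mx -gf -mulmxA fp mulmx1.
Qed.

Lemma rep_iso_cancel U V W (f : 'M_(rdegree U, rdegree V))
    (g : 'M_(rdegree V, rdegree W)) :
  intertwines g -> rep_iso f -> rep_iso (f *m g) -> rep_iso g.
Proof.
move=> Hg [Hf [f' [_ ff' f'f]]] [_ [h [Hh fgh hfg]]].
split=> //; exists (h *m f); split; first exact: intertwinesM.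
  by rewrite -[LHS]mul1mx -f'f -mulmxA (mulmxA g) (mulmxA f) (mulmxA f) fgh mul1mx.
by rewrite -mulmxA.
Qed.

Lemma rep_iso_irr V W (f : 'M_(rdegree V, rdegree W)) :
  rep_iso f -> mx_irreducible V -> mx_irreducible W.
Proof.
case=> Hf [g [_ fg gf]]; apply: mx_rsim_irr.
have eqVW : rdegree V = rdegree W.
  by apply/eqP; rewrite eqn_leq (mulmx1_min fg) (mulmx1_min gf).
by exists f => //; apply/row_freeP; exists g.
Qed.

(** Schur: the kernel of [f] is a submodule of an irreducible module. *)
Lemma Schur_row_free W V (f : 'M_(rdegree W, rdegree V)) :
  mx_irreducible W -> intertwines f -> f != 0 -> row_free f.
Proof.
case=> _ _ simW Hf nzf; rewrite -kermx_eq0; apply: contraNT nzf => nzk.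
suff : (1%:M <= kermx f)%MS by rewrite sub_kermx mul1mx.
apply: simW => //; last exact: submx1.
apply/mxmoduleP=> x Gx.
by rewrite sub_kermx -mulmxA Hf // mulmxA mulmx_ker mul0mx.
Qed.

(** Maschke: average any linear retraction over [G]. *)
Lemma Maschke_retraction (nzG : #|G|%:R != 0 :> K) W V
    (f : 'M_(rdegree W, rdegree V)) :
  intertwines f -> row_free f ->
  exists2 g : 'M_(rdegree V, rdegree W), intertwines g & f *m g = 1%:M.
Proof.
move=> Hf /mulmxVp; move: (pinvmx f) => h fK.
exists (#|G|%:R^-1 *: \sum_(x in G) V x *m h *m W x^-1%g).
  move=> y Gy; rewrite -scalemxAr -scalemxAl; congr (_ *: _).
  rewrite mulmx_sumr mulmx_suml [RHS](reindex_inj (mulgI y)) /=.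
  apply: eq_big => [x|x Gx]; first by rewrite groupMl.
  rewrite invMg !repr_mxM ?groupV ?groupM // -!mulmxA.
  by rewrite -[W y^-1%g *m W y]repr_mxM ?groupV // mulVg repr_mx1 mulmx1.
rewrite -scalemxAr mulmx_sumr (eq_bigr (fun=> 1%:M)) => [|x Gx].
  by rewrite sumr_const -scaler_nat scalerA mulVf // scale1r.
rewrite !mulmxA -Hf // -(mulmxA (W x)) fK mulmx1.
by rewrite -repr_mxM ?groupV // mulgV repr_mx1.
Qed.

(** Over a field without a decision procedure for irreducibility, finding an
irreducible submodule takes excluded middle. *)
Lemma exists_irreducible_sub V :
  (0 < rdegree V)%N ->
  exists (W : representation K G) (u : 'M_(rdegree W, rdegree V)),
    [/\ mx_irreducible W, intertwines u & row_free u].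
Proof.
move=> V_gt0.
apply: NNPP => noW; suff : false by [].
apply: (mxsimple_exists (mxmodule1 V)) => [|[U simU _]].
  by rewrite -mxrank_eq0 mxrank1 -lt0n.
case: noW; have modU := mxsimple_module simU.
exists (Representation (submod_repr modU)), (val_submod 1%:M); split.
- exact/submod_mx_irr.
- by move=> x Gx /=; rewrite -val_submodJ // mul1mx -val_submodE.
- by rewrite /row_free val_submod1.
Qed.

End Intertwiners.

(** * Splitting idempotent matrices *)

Section Compression.

Variables (K : fieldType).

(** If [1 - e] had full rank, it would be invertible, while [e *m (1 - e) = 0]. *)
Lemma rank_compl_lt n (e : 'M[K]_n) :
  e *m e = e -> e != 0 -> (\rank (1%:M - e)%R < n)%N.
Proof.
move=> ee nz_e; rewrite ltn_neqAle rank_leq_row andbT.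
apply: contraNneq nz_e => full.
have unit_c : 1%:M - e \in unitmx by rewrite -row_free_unit /row_free full.
by rewrite -(mulmxK unit_c e) mulmxBr mulmx1 ee subrr mul0mx.
Qed.

(** A full-rank factorization of an idempotent [e] as [e = p *m i] gives
[p *m (i *m p) *m i = p *m i]; cancelling the epi [p] on the left and the mono
[i] on the right leaves [i *m p = 1]. The proof is opaque so that matching up
to conversion never unfolds the factors into Gaussian elimination. *)
Lemma idempotent_splitting n (e : 'M[K]_n) :
  {ip : 'M[K]_(\rank e, n) * 'M[K]_(n, \rank e) |
     ip.2 *m ip.1 = e /\ (e *m e = e -> ip.1 *m ip.2 = 1%:M)}.
Proof.
exists (row_base e, col_base e) => /=; split; first exact: mulmx_base.
have /row_fullP[L] := col_base_full e.
have /row_freeP[M] := row_base_free e.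
move=> + + ee; have := ee; rewrite -{1 2 3}(mulmx_base e).
move: (col_base e) (row_base e) => c r + rK cK.
move/(congr1 (fun A => L *m A *m M)).
by rewrite !mulmxA cK !mul1mx -!mulmxA rK mulmx1 => ->.
Qed.

Definition im_incl n (e : 'M[K]_n) := (sval (idempotent_splitting e)).1.
Definition im_proj n (e : 'M[K]_n) := (sval (idempotent_splitting e)).2.

Lemma im_projK n (e : 'M[K]_n) : im_proj e *m im_incl e = e.
Proof. by rewrite /im_incl /im_proj; case: idempotent_splitting => ? []. Qed.

Lemma im_inclK n (e : 'M[K]_n) : e *m e = e -> im_incl e *m im_proj e = 1%:M.
Proof. by rewrite /im_incl /im_proj; case: idempotent_splitting => ? []. Qed.

Lemma no_rows_eq m n (A B : 'M[K]_(m, n)) : m = 0%N -> A = B.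
Proof. by move=> m0; move: A B; rewrite m0 => A B; rewrite !(flatmx0 _). Qed.

(** The map induced by [f] between the images of two idempotents. It is
functorial in [f] only on maps that commute with the idempotents, whence the
hypothesis of [compressM]. *)
Definition compress m n (e : 'M[K]_m) (e' : 'M[K]_n) (f : 'M_(m, n)) :=
  im_incl e *m f *m im_proj e'.

Lemma im_incl_idem n (e : 'M[K]_n) : e *m e = e -> im_incl e *m e = im_incl e.
Proof. by move=> ee; rewrite -[RHS]mul1mx -(im_inclK ee) -mulmxA im_projK. Qed.

Lemma im_proj_idem n (e : 'M[K]_n) : e *m e = e -> e *m im_proj e = im_proj e.
Proof. by move=> ee; rewrite -[RHS]mulmx1 -(im_inclK ee) mulmxA im_projK. Qed.

Lemma compress1 n (e : 'M[K]_n) : e *m e = e -> compress e e 1%:M = 1%:M.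
Proof. by move=> ee; rewrite /compress mulmx1 im_inclK. Qed.

Lemma compressM m n p (e1 : 'M[K]_m) (e2 : 'M[K]_n) (e3 : 'M[K]_p) f g :
  e1 *m e1 = e1 -> f *m e2 = e1 *m f ->
  compress e1 e2 f *m compress e2 e3 g = compress e1 e3 (f *m g).
Proof.
move=> /im_incl_idem e11 fe; rewrite /compress !mulmxA.
by rewrite -(mulmxA _ (im_proj e2)) im_projK -(mulmxA _ f) fe !mulmxA e11.
Qed.

End Compression.

(** * Images of idempotent endomorphisms *)

Section Images.

Variables (K : fieldType) (gT : finGroupType) (G : {group gT}).
Implicit Types (V W : representation K G) (R S T : pers_rep K G).

Section ImageRepresentation.

Variables (V : representation K G) (e : 'M[K]_(rdegree V)).
Hypotheses (e_idem : e *m e = e) (e_hom : @intertwines K gT G V V e).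

Lemma im_mx_repr : mx_repr G (fun x => compress e e (V x)).
Proof.
split=> [|x y Gx Gy]; first by rewrite repr_mx1 compress1.
by rewrite repr_mxM // compressM ?e_hom.
Qed.

Definition im_rep : representation K G :=
  Representation (MxRepresentation im_mx_repr).

End ImageRepresentation.

Lemma compress_intertwines V W e e' (ee : e *m e = e) (ee' : e' *m e' = e')
    (He : @intertwines K gT G V V e) (He' : @intertwines K gT G W W e')
    (f : 'M_(rdegree V, rdegree W)) :
  intertwines f -> f *m e' = e *m f ->
  @intertwines K gT G (im_rep ee He) (im_rep ee' He') (compress e e' f).
Proof.
by move=> Hf fe x Gx /=; rewrite !compressM ?He ?Hf.
Qed.

Lemma compress_iso V W e e' (ee : e *m e = e) (ee' : e' *m e' = e')
    (He : @intertwines K gT G V V e) (He' : @intertwines K gT G W W e')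
    (f : 'M_(rdegree V, rdegree W)) :
  rep_iso f -> f *m e' = e *m f ->
  @rep_iso K gT G (im_rep ee He) (im_rep ee' He') (compress e e' f).
Proof.
case=> Hf [g [Hg fg gf]] fe.
have ge : g *m e = e' *m g.
  by rewrite -[g *m e]mulmx1 -fg -mulmxA (mulmxA e) -fe !mulmxA gf mul1mx.
split; first exact: compress_intertwines.
exists (compress e' e g); split; first exact: compress_intertwines.
- by rewrite compressM // fg compress1.
- by rewrite compressM // gf compress1.
Qed.

(** The splitting of an idempotent is unique: a retract [W] of [V] whose
idempotent is [e] is the image of [e]. *)
Lemma im_rep_iso V W e (ee : e *m e = e) (He : @intertwines K gT G V V e)
    (p : 'M_(rdegree V, rdegree W)) (i : 'M_(rdegree W, rdegree V)) :
  intertwines p -> intertwines i -> i *m p = 1%:M -> p *m i = e ->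
  @rep_iso K gT G W (im_rep ee He) (i *m im_proj e).
Proof.
move=> Hp Hi ip pi.
have ie : i *m e = i by rewrite -pi mulmxA ip mul1mx.
have ep : e *m p = p by rewrite -pi -mulmxA ip mulmx1.
have cr := im_projK e; have rc := im_inclK ee.
have ce := im_proj_idem ee; have re := im_incl_idem ee.
rewrite /im_rep; split.
  by move=> x Gx /=; rewrite /compress !mulmxA Hi // -(mulmxA i) cr ie.
exists (im_incl e *m p); split.
- move=> x Gx /=; rewrite /compress -!mulmxA -Hp // (mulmxA (im_proj e)) cr.
  by rewrite ep.
- by rewrite mulmxA -(mulmxA i) cr ie.
- by rewrite -mulmxA (mulmxA p) pi ce.
Qed.

Section ImagePersistence.

Variables (R : pers_rep K G) (e : pers_hom R R).
Hypothesis e_idem : forall t, e t *m e t = e t.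

Definition pers_im : pers_rep K G.
Proof.
refine (@PersRep K gT G
  (fun t => im_rep (e_idem t) (@phom_intertwines _ _ _ _ _ e t))
  (fun s t le_st => compress (e s) (e t) (pmap R le_st)) _ _ _).
- move=> s t le_st; apply: compress_intertwines; last by rewrite phom_natural.
  exact: pmap_intertwines.
- by move=> t le_tt; rewrite pmap_id compress1.
- by move=> r s t le_rs le_st le_rt; rewrite compressM ?phom_natural // -pmap_comp.
Defined.

End ImagePersistence.

(** The pointwise inverses of a natural map are natural. Both directions are
stated because comparison maps with a clamped index come in either
orientation. *)
Lemma pers_hom_iso R S (phi : pers_hom R S) :
  (forall t, rep_iso (phi t)) -> pers_iso R S /\ pers_iso S R.
Proof.
move=> phi_iso.
have inv t := rep_iso_pinv (phi_iso t).
have nat s t (le_st : s <= t) :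
    pinvmx (phi s) *m pmap R le_st = pmap S le_st *m pinvmx (phi t).
  have [_ fs sf] := inv s; have [_ ft tf] := inv t.
  move: (pinvmx _) (pinvmx _) fs sf ft tf => g h fs sf ft tf.
  rewrite -[LHS]mulmx1 -ft -mulmxA (mulmxA _ (phi t)) -phom_natural !mulmxA sf.
  by rewrite mul1mx.
have inv_hom t : intertwines (pinvmx (phi t)) by case: (inv t).
pose psi := PersHom inv_hom nat.
by split; [exists phi, psi | exists psi, phi] => t; case: (inv t).
Qed.

Lemma pers_iso_trans R S T : pers_iso R S -> pers_iso S T -> pers_iso R T.
Proof.
case=> [f [f' ff']] [g [g' gg']].
have comp (A B C : pers_rep K G) (u : pers_hom A B) (v : pers_hom B C) :
    {w : pers_hom A C | forall t, w t = u t *m v t}.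
  unshelve eexists (PersHom (phom := fun t => u t *m v t) _ _) => //.
    by move=> t; apply: intertwinesM; apply: phom_intertwines.
  by move=> s t le_st; rewrite -mulmxA phom_natural mulmxA phom_natural mulmxA.
have [w wE] := comp _ _ _ f g; have [w' wE'] := comp _ _ _ g' f'.
exists w, w' => t; rewrite wE wE'; have [f1 f2] := ff' t; have [g1 g2] := gg' t.
split; first by rewrite mulmxA -(mulmxA (f t)) g1 mulmx1.
by rewrite mulmxA -(mulmxA (g' t)) f2 mulmx1.
Qed.

Lemma pers_iso_dadd R S T :
  pers_iso S T -> pers_iso (pers_dadd R S) (pers_dadd R T).
Proof.
have ext (A B : pers_rep K G) (u : pers_hom A B) :
    {w : pers_hom (pers_dadd R A) (pers_dadd R B) |
     forall t, w t = block_mx 1%:M 0 0 (u t)}.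
  unshelve eexists (PersHom
    (phom := (fun t => block_mx 1%:M 0 0 (u t)) :
       forall t, 'M_(rdegree (pers_dadd R A t), rdegree (pers_dadd R B t))) _ _) => //.
    move=> t x Gx /=; rewrite !mulmx_block !(mulmx0, mul0mx, addr0, add0r).
    by rewrite mulmx1 mul1mx phom_intertwines.
  move=> s t le_st /=; rewrite !mulmx_block !(mulmx0, mul0mx, addr0, add0r).
  by rewrite mulmx1 mul1mx phom_natural.
case=> [f [f' ff']]; have [w wE] := ext _ _ f; have [w' wE'] := ext _ _ f'.
exists w, w' => t; rewrite wE wE'; have [f1 f2] := ff' t.
by split; rewrite mulmx_block !(mulmx0, mul0mx, addr0, add0r) mulmx1 ?f1 ?f2
  -scalar_mx_block.
Qed.

Definition pers_compl R (e : pers_hom R R) : pers_hom R R.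
Proof.
refine (@PersHom K gT G R R (fun t => 1%:M - e t) _ _).
- by move=> t; apply: intertwines1B; apply: phom_intertwines.
- by move=> s t le_st; rewrite mulmxBl mulmxBr mul1mx mulmx1 phom_natural.
Defined.

Lemma pers_compl_idem R (e : pers_hom R R) (ee : forall t, e t *m e t = e t) t :
  pers_compl e t *m pers_compl e t = pers_compl e t.
Proof.
by rewrite /= mulmxBr mulmx1 mulmxBl mul1mx ee subrr subr0.
Qed.

(** The two projections, side by side, are inverse to the two inclusions, one
above the other; orthogonality of [e] and [c] kills the cross terms. *)
Lemma pers_im_dadd R (e c : pers_hom R R)
    (ee : forall t, e t *m e t = e t) (cc : forall t, c t *m c t = c t) :
  (forall t, e t *m c t = 0) -> (forall t, c t *m e t = 0) ->
  (forall t, e t + c t = 1%:M) ->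
  pers_iso R (pers_dadd (pers_im ee) (pers_im cc)).
Proof.
move=> ec ce sum; set S := pers_dadd _ _.
have ip0 n (a b : 'M[K]_n) : a *m a = a -> b *m b = b -> a *m b = 0 ->
    im_incl a *m im_proj b = 0.
  move=> aa bb ab; rewrite -(im_incl_idem aa) -(im_proj_idem bb).
  by rewrite mulmxA -(mulmxA (im_incl a)) ab mulmx0 mul0mx.
pose phi t : 'M_(rdegree (R t), rdegree (S t)) :=
  row_mx (im_proj (e t)) (im_proj (c t)).
pose psi t : 'M_(rdegree (S t), rdegree (R t)) :=
  col_mx (im_incl (e t)) (im_incl (c t)).
have phi_hom t : intertwines (phi t).
  move=> x Gx; rewrite /phi /psi /= mul_mx_row mul_row_block !mulmx0 addr0 add0r.
  rewrite /compress !mulmxA !im_projK -!phom_intertwines // -!mulmxA.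
  by rewrite !im_proj_idem.
have phi_nat s t (le_st : s <= t) : phi s *m pmap S le_st = pmap R le_st *m phi t.
  rewrite /phi /= mul_mx_row mul_row_block !mulmx0 addr0 add0r.
  rewrite /compress !mulmxA !im_projK !phom_natural // -!mulmxA.
  by rewrite !im_proj_idem.
have psi_hom t : intertwines (psi t).
  move=> x Gx; rewrite /phi /psi /= mul_block_col mul_col_mx !mul0mx addr0 add0r.
  rewrite /compress -!mulmxA !im_projK !phom_intertwines // !mulmxA.
  by rewrite !im_incl_idem.
have psi_nat s t (le_st : s <= t) : psi s *m pmap R le_st = pmap S le_st *m psi t.
  rewrite /psi /= mul_block_col mul_col_mx !mul0mx addr0 add0r.
  rewrite /compress -!mulmxA !im_projK -!phom_natural // !mulmxA.
  by rewrite !im_incl_idem.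
exists (PersHom phi_hom phi_nat), (PersHom psi_hom psi_nat) => t /=.
rewrite mul_row_col !im_projK sum; split=> //.
by rewrite mul_col_row !im_inclK ?ip0 // -scalar_mx_block.
Qed.

Lemma pers_im_split R (e : pers_hom R R) (ee : forall t, e t *m e t = e t) :
  pers_iso R (pers_dadd (pers_im ee) (pers_im (pers_compl_idem ee))).
Proof.
apply: pers_im_dadd => t /=.
- by rewrite mulmxBr mulmx1 ee subrr.
- by rewrite mulmxBl mul1mx ee subrr.
- by rewrite addrC subrK.
Qed.

End Images.

(** * Clamping the index into a window *)

Section Reindexing.

Variables (K : fieldType) (gT : finGroupType) (G : {group gT}).
Implicit Types R S : pers_rep K G.

(** For equal indices that are not convertible, [pmap R le_st = 1%:M] does not
typecheck; being an isomorphism is the usable form. *)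
Lemma pmap_iso_eq R s t (le_st : s <= t) : s = t -> rep_iso (pmap R le_st).
Proof.
move=> eq_st; case: t / eq_st le_st => le_ss; rewrite pmap_id.
exact: rep_iso1.
Qed.

Definition pers_reindex R (h : int -> int) (h_mono : {homo h : s t / s <= t}) :
  pers_rep K G.
Proof.
refine (@PersRep K gT G (fun t => R (h t))
  (fun s t le_st => pmap R (h_mono s t le_st)) _ _ _).
- by move=> s t le_st; apply: pmap_intertwines.
- by move=> t le_tt; apply: pmap_id.
- by move=> r s t le_rs le_st le_rt; apply: pmap_comp.
Defined.

(** The structure maps [R t -> R (h t)] are the comparison map. *)
Lemma pers_reindex_up R (h : int -> int) (h_mono : {homo h : s t / s <= t})
    (h_up : forall t, t <= h t) :
  (forall t, rep_iso (pmap R (h_up t))) -> pers_iso R (pers_reindex R h_mono).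
Proof.
have nat s t (le_st : s <= t) :
    pmap R (h_up s) *m pmap (pers_reindex R h_mono) le_st
    = pmap R le_st *m pmap R (h_up t).
  by rewrite /= -!(pmap_comp _ _ _ (le_trans le_st (h_up t))).
pose phi := @PersHom K gT G R (pers_reindex R h_mono) _
  (fun t => pmap_intertwines R (h_up t)) nat.
by move=> iso; case: (@pers_hom_iso _ _ _ _ _ phi).
Qed.

(** Dually, the structure maps [R (h t) -> R t] are the comparison map. *)
Lemma pers_reindex_down R (h : int -> int) (h_mono : {homo h : s t / s <= t})
    (h_down : forall t, h t <= t) :
  (forall t, rep_iso (pmap R (h_down t))) -> pers_iso R (pers_reindex R h_mono).
Proof.
have nat s t (le_st : s <= t) :
    pmap R (h_down s) *m pmap R le_st
    = pmap (pers_reindex R h_mono) le_st *m pmap R (h_down t).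
  by rewrite /= -!(pmap_comp _ _ _ (le_trans (h_down s) le_st)).
pose phi := @PersHom K gT G (pers_reindex R h_mono) R _
  (fun t => pmap_intertwines R (h_down t)) nat.
by move=> iso; case: (@pers_hom_iso _ _ _ _ _ phi).
Qed.

Definition iso_outside (p q : int) R :=
  (forall s t (le_st : s <= t), t <= p -> rep_iso (pmap R le_st)) /\
  (forall s t (le_st : s <= t), q <= s -> rep_iso (pmap R le_st)).

Definition clamp (p q t : int) : int := Num.max p (Num.min q t).

Lemma max_mono (p : int) : {homo Num.max p : s t / s <= t}.
Proof. by move=> s t /=; lia. Qed.

Lemma min_mono (q : int) : {homo Num.min q : s t / s <= t}.
Proof. by move=> s t /=; lia. Qed.

Definition pers_clamp (p q : int) R : pers_rep K G :=
  pers_reindex (pers_reindex R (max_mono p)) (min_mono q).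

(** Clamping from below and from above one after the other keeps the comparison
maps natural: each of them is made of structure maps in a single direction. *)
Lemma pers_clamp_iso p q R :
  p <= q -> iso_outside p q R -> pers_iso R (pers_clamp p q R).
Proof.
move=> le_pq [iso_p iso_q].
apply: (@pers_iso_trans _ _ _ _ (pers_reindex R (max_mono p))).
  have up t : t <= Num.max p t by lia.
  apply: (@pers_reindex_up _ _ (max_mono p) up) => t.
  have [le_tp|lt_pt] : t <= p \/ p < t by lia.
    by apply: iso_p; lia.
  by apply: pmap_iso_eq; lia.
have down t : Num.min q t <= t by lia.
apply: (@pers_reindex_down _ _ (min_mono q) down) => t /=.
have [le_tq|lt_qt] : t <= q \/ q < t by lia.
  by apply: pmap_iso_eq; lia.
by apply: iso_q; lia.
Qed.

(** The clamped index is constant on each side of the window. *)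
Lemma pers_clamp_outside p q R : p <= q -> iso_outside p q (pers_clamp p q R).
Proof.
move=> le_pq; split=> s t le_st out;
by apply: (@pmap_iso_eq R _ _ (max_mono p (min_mono q le_st))); lia.
Qed.

Lemma pers_im_outside p q R (e : pers_hom R R) (ee : forall t, e t *m e t = e t) :
  iso_outside p q R -> iso_outside p q (pers_im ee).
Proof.
case=> iso_p iso_q; split=> s t le_st H; apply: compress_iso; rewrite ?phom_natural //.
- exact: iso_p.
- exact: iso_q.
Qed.

End Reindexing.

(** * Structure maps as a total function *)

Section Transition.

Variables (K : fieldType) (gT : finGroupType) (G : {group gT}) (R : pers_rep K G).

(** Extending the structure maps by zero when [t < s] makes the formulas for a
bar vanish by themselves outside of its interval. *)
Definition transition (s t : int) : 'M[K]_(rdegree (R s), rdegree (R t)) :=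
  if (s <= t) =P true is ReflectT le_st then pmap R le_st else 0.

Lemma transitionE s t (le_st : s <= t) : transition s t = pmap R le_st.
Proof.
rewrite /transition; case: eqP => [le_st'|]; last by rewrite le_st.
by rewrite (bool_irrelevance le_st' le_st).
Qed.

Lemma transition_gt s t : t < s -> transition s t = 0.
Proof.
move=> lt_ts; rewrite /transition; case: eqP => // le_st.
by exfalso; move: le_st; rewrite leNgt lt_ts.
Qed.

Lemma transition_hom s t : intertwines (transition s t).
Proof.
by rewrite /transition; case: eqP => *; [apply: pmap_intertwines|apply: intertwines0].
Qed.

Lemma transition1 t : transition t t = 1%:M.
Proof. by rewrite (transitionE (lexx t)) pmap_id. Qed.

Lemma transitionM r s t :
  r <= s -> s <= t -> transition r s *m transition s t = transition r t.
Proof.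
move=> rs st; rewrite (transitionE rs) (transitionE st) (transitionE (le_trans rs st)).
exact/esym/pmap_comp.
Qed.

End Transition.

(** * Extremal indices of a window *)

Lemma int_least (P : pred int) (p t : int) : p <= t -> P t ->
  exists b, [/\ p <= b, b <= t, P b & forall r, p <= r -> r < b -> ~~ P r].
Proof.
move=> le_pt Pt.
have shift r : p <= r -> p + `|r - p|%N = r by lia.
have exP : exists n, P (p + n%:Z) by exists `|t - p|%N; rewrite shift.
case: (ex_minnP exP) => n Pn minn; exists (p + n%:Z); split=> //; first by lia.
  suff : (n <= `|t - p|)%N by lia.
  by apply: minn; rewrite shift.
move=> r le_pr lt_r; apply/negP=> Pr.
suff : (n <= `|r - p|)%N by lia.
by apply: minn; rewrite shift.
Qed.

Lemma int_greatest (P : pred int) (t q : int) : t <= q -> P t ->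
  exists c, [/\ t <= c, c <= q, P c & forall r, c < r -> r <= q -> ~~ P r].
Proof.
move=> le_tq Pt.
have le_qt : - q <= - t by lia.
have [|c [? ? Pc minc]] := @int_least (fun x => P (- x)) _ _ le_qt.
  by rewrite opprK.
exists (- c); split=> //; try lia.
by move=> r lt_cr le_rq; have := minc (- r); rewrite opprK; apply; lia.
Qed.

(** * Bars: the interval summands *)

Section Bars.

Variables (K : fieldType) (gT : finGroupType) (G : {group gT}).

(** A bar [[b, c]] in the window [[p, q]]: [W] is a retract of [R t] for [t] in
[[b, c]], coherently in [t]. The idempotents [bar_proj t *m bar_incl t] are
natural only within the window, since [R] may be nonzero to the left of it. *)
Record bar (R : pers_rep K G) (p q b c : int) (W : representation K G) := Bar {
  bar_incl : forall t, 'M[K]_(rdegree W, rdegree (R t));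
  bar_proj : forall t, 'M[K]_(rdegree (R t), rdegree W);
  bar_incl_hom : forall t, intertwines (bar_incl t);
  bar_proj_hom : forall t, intertwines (bar_proj t);
  bar_inclK : forall t, b <= t -> t <= c -> bar_incl t *m bar_proj t = 1%:M;
  bar_incl_nat : forall s t (le_st : s <= t), b <= s -> t <= c ->
    bar_incl s *m pmap R le_st = bar_incl t;
  bar_incl_lt : forall t, t < b -> bar_incl t = 0;
  bar_proj_gt : forall t, c < t -> bar_proj t = 0;
  bar_natural : forall s t (le_st : s <= t), p <= s -> t <= q ->
    bar_proj s *m bar_incl s *m pmap R le_st
    = pmap R le_st *m (bar_proj t *m bar_incl t)
}.

(** Take [b] as the first index of the window with [R b] nonzero and [c] as the
last one that an irreducible [W] in [R b] reaches; a retraction at [c] pulls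
back to retractions at all earlier indices. *)
Lemma exists_bar (nzG : #|G|%:R != 0 :> K) (R : pers_rep K G) (p q t0 : int) :
  p <= t0 -> t0 <= q -> (0 < rdegree (R t0))%N ->
  exists (b c : int) (W : representation K G),
    [/\ p <= b, b <= c, c <= q, mx_irreducible W & inhabited (bar R p q b c W)].
Proof.
move=> le_pt le_tq; case/(int_least le_pt (P := fun t => 0 < rdegree (R t))%N).
move=> b [le_pb le_bt Rb_gt0 low].
have [W [u [irrW u_hom u_free]]] := exists_irreducible_sub Rb_gt0.
have [||c [le_bc le_cq nz_c high]] :=
    @int_greatest (fun t => u *m transition R b t != 0) b q.
- exact: le_trans le_tq.
- rewrite transition1 mulmx1 -mxrank_eq0 (eqP u_free) -lt0n.
  by case/mx_irrP: irrW.
have uc_hom := intertwinesM u_hom (@transition_hom _ _ _ R b c).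
have [pi pi_hom piK] := Maschke_retraction nzG uc_hom (Schur_row_free irrW uc_hom nz_c).
exists b, c, W; split=> //; constructor.
apply: (@Bar _ _ _ _ _ _ (fun t => u *m transition R b t)
                          (fun t => transition R t c *m pi)).
- by move=> t; apply: intertwinesM => //; apply: transition_hom.
- by move=> t; apply: intertwinesM => //; apply: transition_hom.
- by move=> t bt tc; rewrite mulmxA -(mulmxA u) transitionM.
- by move=> s t le_st bs tc; rewrite -(transitionE R le_st) -mulmxA transitionM.
- by move=> t lt_tb; rewrite transition_gt ?mulmx0.
- by move=> t lt_ct; rewrite transition_gt ?mul0mx.
move=> s t le_st le_ps le_tq'; rewrite -(transitionE R le_st).
(* Left of the bar, [R s] is zero because [b] is the first nonzero index. *)
have [lt_sb|le_bs] := ltP s b.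
  have /eqP Rs0 : rdegree (R s) == 0%N by have := low s le_ps lt_sb; rewrite lt0n negbK.
  exact: no_rows_eq.
rewrite -!mulmxA transitionM //.
(* Right of the bar, the image of [u] has died because [c] is maximal. *)
have [le_tc|lt_ct] := leP t c; first by rewrite !mulmxA transitionM.
have /negbNE/eqP -> : ~~ (u *m transition R b t != 0) by exact: high.
by rewrite (transition_gt _ lt_ct) !(mul0mx, mulmx0).
Qed.

Section BarSummand.

Variables (R : pers_rep K G) (p q b c : int) (W : representation K G).
Hypotheses (le_pb : p <= b) (le_bc : b <= c) (le_cq : c <= q).
Variable B : bar R p q b c W.

Definition bar_idem t := bar_proj B t *m bar_incl B t.

Lemma bar_idem_hom t : @intertwines K gT G (R t) (R t) (bar_idem t).
Proof. exact: intertwinesM (bar_proj_hom B t) (bar_incl_hom B t). Qed.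

Lemma bar_idem_idem t : bar_idem t *m bar_idem t = bar_idem t.
Proof.
rewrite /bar_idem; have [lt_tb|le_bt] := ltP t b.
  by rewrite bar_incl_lt // !mulmx0.
have [le_tc|lt_ct] := leP t c; last by rewrite bar_proj_gt // !mul0mx.
by rewrite mulmxA -(mulmxA (bar_proj B t)) bar_inclK // mulmx1.
Qed.

Lemma bar_idem_out t : ~~ (b <= t <= c) -> bar_idem t = 0.
Proof.
rewrite /bar_idem; have [lt_tb _|le_bt /=] := ltP t b.
  by rewrite bar_incl_lt // mulmx0.
by rewrite -ltNge => lt_ct; rewrite bar_proj_gt // mul0mx.
Qed.

Lemma bar_idem_neq0 t : (0 < rdegree W)%N -> b <= t -> t <= c -> bar_idem t != 0.
Proof.
move=> W_gt0 le_bt le_tc; apply: contraTneq W_gt0 => e0; rewrite lt0n negbK.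
have : bar_incl B t *m bar_idem t *m bar_proj B t = 1%:M.
  by rewrite /bar_idem !mulmxA bar_inclK // mul1mx bar_inclK.
by rewrite e0 mulmx0 mul0mx => /(congr1 mxrank); rewrite mxrank1 mxrank0 => <-.
Qed.

(** On the clamped representation the idempotents of a bar are natural
everywhere, since only indices of the window are visited. *)
Definition bar_endo : pers_hom (pers_clamp p q R) (pers_clamp p q R).
Proof.
refine (@PersHom K gT G (pers_clamp p q R) (pers_clamp p q R)
  (fun t => bar_idem (clamp p q t)) _ _).
- by move=> t; apply: bar_idem_hom.
- by move=> s t le_st; apply: (bar_natural B (max_mono p (min_mono q le_st))); lia.
Defined.

Lemma bar_endo_idem t : bar_endo t *m bar_endo t = bar_endo t.
Proof. exact: bar_idem_idem. Qed.

(** An end of the bar at an end of the window extends to infinity, the clamped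
representation being constant there. *)
Definition bar_itv :=
  closed_itv (if b == p then None else Some b) (if c == q then None else Some c).

Lemma mem_bar_itv t : (t \in bar_itv) = (b <= clamp p q t <= c).
Proof.
rewrite /bar_itv /clamp itv_boundlr.
by case: (b =P p) => Hb; case: (c =P q) => Hc; rewrite /= ?bnd_simp; lia.
Qed.

(** At each index of the bar the image is a copy of [W], and the structure maps
of the image match these copies. *)
Lemma bar_irreducible :
  mx_irreducible W -> pers_irreducible_on bar_itv (pers_im bar_endo_idem).
Proof.
have irr_iso r : b <= clamp p q r -> clamp p q r <= c ->
    rep_iso (bar_incl B (clamp p q r) *m im_proj (bar_endo r) :
             'M_(rdegree W, rdegree (pers_im bar_endo_idem r))).
  move=> br rc; apply: (im_rep_iso _ _ (bar_proj_hom B _) (bar_incl_hom B _)) => //.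
  exact: bar_inclK.
move=> irrW; split=> [t|t|s t le_st]; rewrite !mem_bar_itv.
- by move=> /andP[bt tc]; apply: rep_iso_irr (irr_iso t bt tc) irrW.
- by move=> out; rewrite /= bar_idem_out ?mxrank0.
move=> /andP[bs sc] /andP[bt tc]; set f := pmap _ le_st.
apply: (rep_iso_cancel (pmap_intertwines _ le_st) (irr_iso s bs sc)).
suff -> : bar_incl B (clamp p q s) *m im_proj (bar_endo s) *m f
    = bar_incl B (clamp p q t) *m im_proj (bar_endo t) by apply: irr_iso.
rewrite /f /= /compress !mulmxA -(mulmxA _ _ (im_incl _)) im_projK /bar_idem.
by rewrite !mulmxA bar_inclK // mul1mx bar_incl_nat.
Qed.

End BarSummand.

End Bars.

(** * The decomposition *)

Section Decomposition.

Variables (K : fieldType) (gT : finGroupType) (G : {group gT}).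
Implicit Type R : pers_rep K G.

Lemma pers_iso_zero R :
  (forall t, rdegree (R t) = 0%N) -> pers_iso R pers_zero.
Proof.
move=> R0.
have hom0 (S T : pers_rep K G) : {w : pers_hom S T | forall t, w t = 0}.
  have hom t : @intertwines K gT G (S t) (T t) 0 by exact: intertwines0.
  have nat s t (le_st : s <= t) : 0 *m pmap T le_st = pmap S le_st *m 0.
    by rewrite mulmx0 mul0mx.
  by exists (PersHom hom nat).
have [phi _] := hom0 R pers_zero; have [psi _] := hom0 pers_zero R.
by exists phi, psi => t; split; apply: no_rows_eq.
Qed.

Definition decomposable R :=
  exists n (s t : 'I_n -> option int) (Ri : 'I_n -> pers_rep K G),
    (forall i, (exists r : int, r \in closed_itv (s i) (t i)) /\
       pers_irreducible_on (closed_itv (s i) (t i)) (Ri i)) /\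
    pers_iso R (\big[@pers_dadd K gT G/pers_zero]_(i < n) Ri i).

Lemma decomposable_dadd R A C s t :
  (exists r : int, r \in closed_itv s t) ->
  pers_irreducible_on (closed_itv s t) A ->
  pers_iso R (pers_dadd A C) -> decomposable C -> decomposable R.
Proof.
move=> st_ne irrA R_AC [n [s' [t' [Ci [irrC C_sum]]]]].
pose ext T (x : T) (f : 'I_n -> T) (i : 'I_n.+1) :=
  if unlift ord0 i is Some j then f j else x.
exists n.+1, (ext _ s s'), (ext _ t t'), (ext _ A Ci); split.
  by move=> i; rewrite /ext; case: (unlift ord0 i) => [j|].
rewrite big_ord_recl {1}/ext unlift_none.
under eq_bigr do rewrite /ext liftK.
exact: pers_iso_trans R_AC (pers_iso_dadd _ C_sum).
Qed.

Definition total_degree (p q : int) R :=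
  (\sum_(k < `|(q - p)%R|.+1) rdegree (R ((p + k%:Z)%R)))%N.

(** Induction on the total degree over the window. The summand split off is
nonzero at [b], so the complement has smaller total degree. *)
Lemma decomposable_window (nzG : #|G|%:R != 0 :> K) (p q : int) R :
  p <= q -> iso_outside p q R -> decomposable R.
Proof.
move=> le_pq; have [m] := ubnP (total_degree p q R).
elim: m => // m IHm in R *; rewrite ltnS => le_deg R_out.
have R_clamp := pers_clamp_iso le_pq R_out.
have in_window t : exists k : 'I_`|q - p|.+1, p + k%:Z = clamp p q t.
  have lt_k : (`|clamp p q t - p| < `|q - p|.+1)%N by rewrite /clamp; lia.
  by exists (Ordinal lt_k) => /=; rewrite /clamp; lia.
have [/existsP[k0 Rk_gt0]|no_degree] :=
    boolP [exists k : 'I_`|q - p|.+1, (0 < rdegree (R (p + k%:Z)%R))%N]; last first.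
  (* Zero throughout the window means zero after clamping: the empty sum. *)
  exists 0%N, (fun=> None), (fun=> None), (fun=> pers_zero); split; first by case.
  rewrite big_ord0; apply: pers_iso_trans R_clamp (pers_iso_zero _) => t.
  have [k eq_k] := in_window t.
  by have := existsPn no_degree k; rewrite eq_k -eqn0Ngt => /eqP.
have le_pk : p <= p + k0%:Z by lia.
have le_kq : p + k0%:Z <= q by have := ltn_ord k0; lia.
have [b [c [W [le_pb le_bc le_cq irrW [B]]]]] := exists_bar nzG le_pk le_kq Rk_gt0.
have clamp_in r : p <= r -> r <= q -> clamp p q r = r by rewrite /clamp; lia.
have le_bq := le_trans le_bc le_cq.
have split_R := pers_iso_trans R_clamp
  (pers_im_split (bar_endo_idem le_pb le_bc le_cq B)).
have b_in : b \in closed_itv (if b == p then None else Some b)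
                             (if c == q then None else Some c).
  by rewrite (mem_bar_itv le_pb le_bc le_cq) clamp_in ?lexx.
apply: decomposable_dadd (ex_intro _ b b_in) (bar_irreducible _ _ _ _ irrW) split_R _.
apply: IHm; last by apply: pers_im_outside; apply: pers_clamp_outside.
apply: leq_trans le_deg.
have [kb eq_kb] := in_window b; rewrite clamp_in // in eq_kb.
rewrite /total_degree (bigD1 kb) // [in ltnRHS](bigD1 kb) //= -addSn.
have clamp_k (k : 'I_`|q - p|.+1) : clamp p q (p + k%:Z)%R = p + k%:Z.
  by have := ltn_ord k; rewrite /clamp; lia.
apply: leq_add; last first.
  apply: leq_sum => k _; rewrite -[X in (_ <= rdegree (R X))%N]clamp_k.
  exact: rank_leq_row.
rewrite -[X in (_ < rdegree (R X))%N]clamp_k.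
apply: rank_compl_lt; first exact: bar_idem_idem.
have [W_gt0 _] := proj1 (mx_irrP W) irrW.
by apply: bar_idem_neq0 => //; rewrite -/(clamp p q _) clamp_k eq_kb.
Qed.

End Decomposition.

Theorem theorem0p1p2 (K : fieldType) (gT : finGroupType) (G : {group gT})
    (charK0 : [pchar K] =i pred0)
    (R : pers_rep K G) (finR : pers_finite R) :
  exists (I : finType) (s t : I -> option int) (Ri : I -> pers_rep K G),
    (forall i : I,
       (exists r : int, r \in closed_itv (s i) (t i)) /\
       pers_irreducible_on (closed_itv (s i) (t i)) (Ri i)) /\
    pers_iso R (\big[@pers_dadd K gT G/pers_zero]_(i : I) Ri i).
Proof.
case: finR => p [q [iso_p iso_q]].
have nzG : #|G|%:R != 0 :> K by move/pcharf0P: charK0 => ->; rewrite -lt0n cardG_gt0.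
(* The given thresholds may be in the wrong order. *)
have le_pm : p <= Num.max p q by lia.
have R_out : iso_outside p (Num.max p q) R.
  by split=> // s t le_st ge_s; apply: iso_q; lia.
by have [n] := decomposable_window nzG le_pm R_out; exists 'I_n.
Qed.
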